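(* Let $r \geq 1$ be an integer and let $t = 1260 r + 169$. Then $$f(n) \geq n + \frac{119}{3}t - \frac{26399}{3}$$ for every integer $n$ satisfying $$n \geq \frac{1309}{2}t^{2} - \frac{1349159}{6}t + \frac{6932215}{3}.$$
   Context: Graphs are finite and undirected; loops and multiple edges are allowed, a loop being a cycle of length $1$ and a pair of parallel edges forming a cycle of length $2$. For a positive integer $n$, $f(n)$ denotes the maximum number of edges in a graph with $n$ vertices in which no two distinct cycles have the same length. *)

(* Defs.v *)
From HB Require Import structures.
From mathcomp Require Import all_boot.

Set Implicit Arguments.
Unset Strict Implicit.
Unset Printing Implicit Defensive.

(* Edges are labelled by E, so parallel edges are distinct labels with equal
   sets of ends; a loop is an edge whose set of ends is a singleton. *)
Record mgraph (V E : finType) := MGraph {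
  ends :> {ffun E -> {set V}};
  _ : [forall e, 0 < #|ends e| <= 2] }.

HB.instance Definition _ (V E : finType) := [isSub for @ends V E].
HB.instance Definition _ (V E : finType) := [Countable of mgraph V E by <:].
HB.instance Definition _ (V E : finType) := [Finite of mgraph V E by <:].

Section Cycles.
Variables (V E : finType) (G : mgraph V E).

(* For x = y this says that e is a loop at x. *)
Definition joins (e : E) (x y : V) : bool := ends G e == [set x; y].

(* A cycle is identified with its edge set C: for k = #|C| > 0 there are
   distinct vertices v_0, ..., v_(k-1) and distinct edges e_0, ..., e_(k-1),
   the elements of C, with e_i joining v_i to v_(i+1 mod k).  Its length is
   #|C|; k = 1 gives a loop and k = 2 a pair of parallel edges. *)
Definition is_cycle (C : {set E}) : bool :=
  (0 < #|C|) &&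
  [exists v : {ffun 'I_#|C| -> V}, exists e : {ffun 'I_#|C| -> E},
     [&& injectiveb v, injectiveb e, e @: [set: 'I_#|C|] == C
       & [forall i, joins (e i) (v i) (v (ordS i))]]].

Definition distinct_cycle_lengths : bool :=
  [forall C : {set E}, forall D : {set E},
     [&& is_cycle C, is_cycle D & #|C| == #|D|] ==> (C == D)].

Lemma is_cycle_loop (e : E) (x : V) : joins e x x -> is_cycle [set e].
Proof.
move=> Gexx; rewrite /is_cycle {1}cards1 /=.
have inj1 (T : eqType) (h : 'I_#|[set e]| -> T) : injective h.
  move=> i j _; apply: val_inj.
  have lt1 (k : 'I_#|[set e]|) : k = 0 :> nat.
    by apply/eqP; rewrite -leqn0 -ltnS -(cards1 e) ltn_ord.
  by rewrite /= !lt1.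
apply/existsP; exists [ffun=> x]; apply/existsP; exists [ffun=> e].
apply/and4P; split; [exact/injectiveP/inj1 | exact/injectiveP/inj1 | |].
  rewrite eqEcard (card_imset _ (inj1 _ _)) cardsT card_ord leqnn andbT.
  by apply/subsetP=> _ /imsetP[i _ ->]; rewrite ffunE inE.
by apply/forallP=> i; rewrite !ffunE.
Qed.

Lemma is_cycle_parallel (e e' : E) (x y : V) :
  e != e' -> x != y -> joins e x y -> joins e' x y -> is_cycle [set e; e'].
Proof.
move=> nee' nxy Ge Ge'; have c2 : #|[set e; e']| = 2 by rewrite cards2 nee'.
rewrite /is_cycle {1}c2 /=.
have lt2 (k : 'I_#|[set e; e']|) : k < 2 by rewrite -[2]c2 ltn_ord.
have inj2 (T : eqType) (a b : T) : a != b ->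
    injective [ffun i : 'I_#|[set e; e']| => if val i == 0 then a else b].
  move=> nab i j; rewrite !ffunE => h; apply: val_inj => /=; move: h.
  have := lt2 i; have := lt2 j.
  case: i j => [[|[|i]] ?] [[|[|j]] ?] //= _ _ ab; move: nab;
  by rewrite ab eqxx.
apply/existsP; exists [ffun i => if val i == 0 then x else y].
apply/existsP; exists [ffun i => if val i == 0 then e else e'].
apply/and4P; split; [exact/injectiveP/inj2 | exact/injectiveP/inj2 | |].
  rewrite eqEcard (card_imset _ (inj2 _ _ _ nee')) cardsT card_ord leqnn andbT.
  apply/subsetP=> _ /imsetP[i _ ->]; rewrite ffunE !inE.
  by case: ifP; rewrite eqxx ?orbT.
apply/forallP=> i; rewrite !ffunE /=.
have := lt2 i; move: (i : nat) => {}i; rewrite c2; case: i => [|[|i]] //= _.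
by rewrite /joins setUC; apply: Ge'.
Qed.

Lemma card_ends_fiber (A : {set V}) :
  distinct_cycle_lengths -> #|[set e | ends G e == A]| <= 2.
Proof.
move=> /'forall_forallP dG; rewrite leqNgt; apply/negP.
move=> /card_gt2P[a [b [c [[]]]]]; rewrite !inE.
move=> Ga Gb Gc [nab nbc nca].
have := valP G => /forallP/(_ a); rewrite /= (eqP Ga) => /andP[A0 A2].
case: (set_0Vmem A) => [A_0|[x xA]]; first by rewrite A_0 cards0 in A0.
case: (set_0Vmem (A :\ x)) => [Ax|[y]].
  have Axx : A = [set x; x] by rewrite -(setD1K xA) Ax setU0 setUid.
  have L e : ends G e == A -> is_cycle [set e].
    by move=> Ge; apply: (@is_cycle_loop e x); rewrite /joins -Axx.
  have := dG [set a] [set b]; rewrite !L // !cards1 eqxx /= => /eqP/set1_inj ab.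
  by rewrite ab eqxx in nab.
rewrite !inE => /andP[nyx yA].
have Axy : A = [set x; y].
  apply/esym/eqP; rewrite eqEcard cards2 eq_sym nyx A2 andbT.
  by apply/subsetP=> z; rewrite !inE => /orP[]/eqP->.
have P e e' : e != e' -> ends G e == A -> ends G e' == A ->
    is_cycle [set e; e'].
  move=> nee Ge Ge'; apply: (@is_cycle_parallel e e' x y) => //.
  - by rewrite eq_sym.
  - by rewrite /joins -Axy.
  - by rewrite /joins -Axy.
have := dG [set a; b] [set b; c]; rewrite !P // !cards2 nab nbc eqxx /=.
move=> /eqP/setP/(_ a); rewrite !inE eqxx /= (negPf nab) /= => /esym/eqP ac.
by rewrite ac eqxx in nca.
Qed.

End Cycles.

Definition realizable (n m : nat) : bool :=
  [exists G : mgraph 'I_n 'I_m, distinct_cycle_lengths G].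

Lemma realizable_ex (n : nat) : exists m, realizable n m.
Proof.
exists 0; apply/existsP.
have h : [forall e, 0 < #|[ffun _ : 'I_0 => set0 : {set 'I_n}] e| <= 2].
  by apply/forallP=> [[]].
exists (MGraph h); apply/'forall_forallP=> C D; apply/implyP=> _.
by apply/eqP/setP=> [[]].
Qed.

Lemma realizable_bounded (n m : nat) : realizable n m -> m <= 2 ^ n * 2.
Proof.
move=> /existsP[G dG]; rewrite -[m in m <= _]card_ord -sum1_card.
rewrite (partition_big (ends G) predT) //=.
have <- : #|{set 'I_n}| = 2 ^ n.
  by rewrite -cardsT -powersetT card_powerset cardsT card_ord.
rewrite -sum_nat_const; apply: leq_sum => A _.
by rewrite sum1_card -cardsE; apply: card_ends_fiber.
Qed.

(* The maximum number of edges; the bound above only ensures that it exists. *)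
Definition f (n : nat) : nat :=
  ex_maxn (realizable_ex n) (@realizable_bounded n).

(* Main.v *)
Require Import Defs.
From HB Require Import structures.
From mathcomp Require Import all_boot all_order all_algebra.
From mathcomp Require Import zify lra.
Import Order.TTheory GRing.Theory Num.Theory.

(** Only blocks glued together at one vertex, the hub, are needed.  A cycle lies
    in one block, so the task is to choose blocks whose cycles have pairwise
    distinct lengths, with as few vertices as possible for a given cyclomatic
    number.

    A block is either a single cycle, or a fan: a cycle through the hub with
    six more paths (spokes) from the hub to the joints 1, ..., 6 of that cycle.
    With the hub counted as joint 0 and as joint 7, the fan has one cycle for
    each pair i < j, formed by the spokes i and j and the rim between these
    joints: 28 cycles for a cyclomatic number of 7 ([circuit_bouquet]).  If the
    joint j has position P_j on the rim and a spoke of length s_j, the length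
    of this cycle is U_j + V_i, where U_j = s_j + P_j and V_i = s_i - P_i.
    Every edge of the fan lies on two of the eight cycles (0, 1), (1, 2), ...,
    (6, 7) and (0, 7), so the fan has only half as many edges as these eight
    cycles together.  This is what makes fans cheaper than single cycles, which
    remain the best choice for short lengths.

    Divide the lengths into cells [2wc, 2w(c+1)).  The 2w - 24 fans of the
    construction are perturbations of one shape, with
      U = 11, 19, 20, 29, 34, 40, 39 and V = 0, -4, -8, -12, -16, -26, -29
    in units of 2w, for which the 28 sums U_j + V_i are distinct and at least
    10.  The shape comes from a computer search.  Each pair (i, j) owns one
    cell, and the lengths below 20w are left for the single cycles.  This costs
    at most 480w^2 edges for a cyclomatic number of 34w - 169
    ([family_realizable]).  The bound follows because the ratio
    34^2/480 = 289/120 exceeds (119/3)^2/(1309/2) = 238/99; w = 1470r - 56 gives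
    the number of edges that is required.

    It remains to place the 2w - 24 fans inside the cells.  Moving a fan by one
    unit in all cells at once is impossible, because
      (U_j + V_i) + (U_k + V_j) - (U_k + V_i) = 2 s_j
    is even for i < j < k.  Instead, eight consecutive fans form a tile in
    which every pair (i, j) takes the eight residues modulo 8 once, and the
    tile is moved by 8.  The displayed sums being even, each fan gives every
    joint a parity such that the cycle of (i, j) is odd when i and j differ; in
    a tile, any two joints have to agree in four fans and differ in four.  The
    table behind [offset_inj] achieves this, and the residues, for the joints
    0 and 2, ..., 6 only.  The joint 1 always has the parity of the joint 0, and
    the joint 7 is always opposite to the joint 6.  Hence all cycles of the pair
    (0, 1) are even and those of (6, 7) are odd, and these two pairs share the
    cells 10 and 11, each taking one half of both.

    On the graph side, a cycle is treated as a minimal nonempty set of edges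
    that has even degree everywhere ([cycle_circuit]).  This notion is stable
    under subdivision of edges ([circuit_sub_lift]), which reduces the
    classification of cycles to the bouquet of fans with edges of length 1.
    Pendant edges use up the remaining vertices. *)

Set Implicit Arguments.
Unset Strict Implicit.
Unset Printing Implicit Defensive.

(** * Even sets of edges and cycles *)

Lemma xor_sum_mem (I : finType) (A : {set I}) (a : I) :
  \big[addb/false]_(i in A) (i == a) = (a \in A).
Proof.
case: (boolP (a \in A)) => [aA|naA].
  rewrite (bigD1 a) //= eqxx big1 // => i /andP[_ ia]; exact: negPf ia.
rewrite big1 // => i iA; apply/negbTE; apply: contraNneq naA => <- //.
Qed.

Lemma xor_telescope (f : nat -> bool) m n : m <= n ->
  \big[addb/false]_(m <= i < n) (f i (+) f i.+1) = f m (+) f n.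
Proof.
elim: n => [|n IHn]; first by rewrite leqn0 => /eqP->; rewrite big_geq // addbb.
rewrite leq_eqVlt => /predU1P[<-|mn]; first by rewrite big_geq // addbb.
rewrite big_nat_recr //= IHn // addbA -(addbA (f m)) addbb addbF //.
Qed.

(** The boundary of an arc depends only on its set of ends, a loop having none. *)
Lemma xor_ends (V : finType) (a b x : V) :
  (a == x) (+) (b == x) = (#|[set a; b]| == 2) && (x \in [set a; b]).
Proof.
rewrite cards2 !inE (eq_sym x a) (eq_sym x b).
have [<-|ab] := eqVneq a b; first by rewrite addbb.
by have [<-|ax] /= := eqVneq a x; rewrite 1?eq_sym ?(negPf ab).
Qed.

Lemma ordS_closed_full n (J : {set 'I_n}) (i0 : 'I_n) :
  i0 \in J -> (forall i, i \in J -> ordS i \in J) -> J = [set: 'I_n].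
Proof.
move=> J0 JS; have Jk k : iter k (@ordS n) i0 \in J by elim: k => //= k /JS.
have vk k : iter k (@ordS n) i0 = (i0 + k) %% n :> nat.
  elim: k => [|k IHk] /=; first by rewrite addn0 modn_small.
  by rewrite IHk addnS -(addn1 (_ %% _)) modnDml addn1.
apply/setP=> j; rewrite inE.
suff -> : j = iter (j + (n - i0)) (@ordS n) i0 by exact: Jk.
apply: ord_inj; rewrite vk addnCA subnKC ?(ltnW (ltn_ord i0)) //.
by rewrite modnDr modn_small.
Qed.

Section ArcGraph.
Variables (V E : finType) (src dst : E -> V).

Lemma arc_ends_card :
  [forall e, 0 < #|[ffun e : E => [set src e; dst e]] e| <= 2].
Proof. by apply/forallP => e; rewrite ffunE cards2; case: eqP. Qed.

Definition arc_graph : mgraph V E := MGraph arc_ends_card.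

(** The exclusive or makes a loop, which meets its vertex twice, contribute 0. *)
Definition boundary (e : E) (x : V) : bool := (src e == x) (+) (dst e == x).

Definition odd_at (C : {set E}) (x : V) : bool :=
  \big[addb/false]_(e in C) boundary e x.

Definition even_set (C : {set E}) : bool := [forall x, ~~ odd_at C x].

(** A description of the edge sets of cycles that mentions neither vertices nor an
    order of the edges; see [cycle_circuit]. *)
Definition circuit (C : {set E}) : bool :=
  minset (fun D => (D != set0) && even_set D) C.

Lemma even_setP (C : {set E}) : reflect (forall x, odd_at C x = false) (even_set C).
Proof.
by apply: (iffP forallP) => H x; [apply: negbTE (H x) | rewrite H].
Qed.

Lemma circuit_minimal (C D : {set E}) :
  circuit C -> D \subset C -> D != set0 -> even_set D -> D = C.
Proof. by move=> cC DC D0 De; apply: (minsetinf cC) DC; rewrite D0. Qed.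

Lemma circuit_even (C : {set E}) : circuit C -> even_set C.
Proof. by move=> /minsetp /andP[]. Qed.

Lemma circuit_neq0 (C : {set E}) : circuit C -> C != set0.
Proof. by move=> /minsetp /andP[]. Qed.

(** Handshaking: each arc has an even number of ends, so the vertices of odd
    degree cannot be reduced to a single one. *)
Lemma even_set_except (C : {set E}) (x0 : V) :
  (forall x, x != x0 -> odd_at C x = false) -> even_set C.
Proof.
move=> Cx; apply/even_setP => x; have [->|/Cx //] := eqVneq x x0.
have : \big[addb/false]_x odd_at C x = false.
  rewrite exchange_big big1 // => e _; rewrite big_split /=.
  have one (y : V) : \big[addb/false]_z (y == z) = true.
    rewrite (bigD1 y) //= eqxx big1 // => z zy.
    by rewrite eq_sym; apply: negPf.
  by rewrite !one.
by rewrite (bigD1 x0) //= big1 // addbF.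
Qed.

(** At each vertex of the cycle, an even subset contains both or none of the two
    consecutive edges that meet there, so it is empty or everything. *)
Lemma cycle_circuit (C : {set E}) : is_cycle arc_graph C -> circuit C.
Proof.
move=> /andP[C0 /existsP[v /existsP[e /and4P[/injectiveP vI /injectiveP eI]]]].
move=> eC /forallP vJ.
have inC i : e i \in C by have := imset_f e (in_setT i); rewrite (eqP eC).
have Cin a : a \in C -> exists i, a = e i.
  by move/eqP/setP/(_ a): eC => <- /imsetP[i _ ->]; exists i.
have bdE i x : boundary (e i) x = (v i == x) (+) (v (ordS i) == x).
  by rewrite /boundary !xor_ends; have /eqP := vJ i; rewrite /= ffunE => ->.
have oddE (D : {set E}) x : D \subset C ->
    odd_at D x = \big[addb/false]_(i in [set i | e i \in D])
                    ((v i == x) (+) (v (ordS i) == x)).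
  move=> /subsetP DC; rewrite /odd_at.
  have eD : D = e @: [set i | e i \in D].
    apply/setP=> a; apply/idP/imsetP => [aD|[i iD ->]]; last by rewrite inE in iD.
    by have [i ai] := Cin _ (DC _ aD); exists i; rewrite // inE -ai.
  rewrite {1}eD big_imset //=; last by move=> i j _ _; apply: eI.
  by apply: eq_bigr => i _; apply: bdE.
have vS (D : {set E}) x i : v (ordS i) = x -> D \subset C ->
    odd_at D x = (ordS i \in [set i | e i \in D]) (+) (e i \in D).
  move=> <- DC; rewrite oddE // big_split /=; congr (_ (+) _).
    under eq_bigr => j _ do rewrite (inj_eq vI).
    by rewrite xor_sum_mem.
  under eq_bigr => j _ do rewrite (inj_eq vI) (inj_eq (can_inj (@ordSK _))).
  by rewrite xor_sum_mem inE.
apply/minsetP; split=> [|D /andP[D0 De] DC].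
  rewrite -card_gt0 C0; apply/even_setP => x; rewrite oddE // big_split /=.
  have full i : i \in [set i | e i \in C] by rewrite inE inC.
  rewrite (reindex_inj (can_inj (@ordSK _))) /=.
  under eq_bigl => i do rewrite full -(full i).
  by rewrite addbb.
have [a aD] := set0Pn _ D0.
have [i0 ai0] := Cin _ (subsetP DC _ aD).
have JT : [set i | e i \in D] = [set: 'I_#|C|].
  apply: (@ordS_closed_full _ _ i0); first by rewrite inE -ai0.
  move=> i; rewrite inE => iD; have /even_setP/(_ (v (ordS i))) := De.
  by rewrite (vS _ _ i) // iD addbT => /negbFE.
apply/eqP; rewrite eqEsubset DC; apply/subsetP => _ /Cin[i ->].
by have := in_setT i; rewrite -JT inE.
Qed.

End ArcGraph.

(** * Subdivision *)

Section Subdivision.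
Variables (V E : finType) (src dst : E -> V) (len : E -> nat).
Hypothesis len_gt0 : forall e, 0 < len e.

Definition sub_vertex : finType := (V + {e : E & 'I_(len e).-1})%type.
Definition sub_edge : finType := {e : E & 'I_(len e)}.

Definition inner_vertex (e : E) (o : 'I_(len e).-1) : sub_vertex :=
  inr (@Tagged E e (fun e => 'I_(len e).-1) o).

(** The i-th vertex of the path of length [len e] that replaces e. *)
Definition sub_point (e : E) (i : nat) : sub_vertex :=
  if i is i'.+1 then
    if (insub i' : option 'I_(len e).-1) is Some o then inner_vertex o else inl (dst e)
  else inl (src e).

Definition sub_src (x : sub_edge) : sub_vertex := sub_point (tag x) (tagged x).
Definition sub_dst (x : sub_edge) : sub_vertex :=
  sub_point (tag x) (tagged x).+1.

Definition sub_lift (D : {set E}) : {set sub_edge} := [set x | tag x \in D].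

Definition arc (e : E) (i : nat) (lt_i : i < len e) : sub_edge :=
  @Tagged E e (fun e => 'I_(len e)) (Ordinal lt_i).

Lemma sub_point_len e : sub_point e (len e) = inl (dst e).
Proof.
have -> : sub_point e (len e) = sub_point e (len e).-1.+1 by rewrite prednK.
by rewrite /sub_point insubF ?ltnn.
Qed.

Lemma sub_point_inner e i e' (o : 'I_(len e').-1) :
  (sub_point e i == inner_vertex o) = (e == e') && (i == o.+1).
Proof.
rewrite /sub_point; case: i => [|i]; first by rewrite andbF.
case: insubP => [o' _ <-|ei].
  apply/eqP/andP => [eo|[/eqP ee']].
    have /= ee' := congr1 (fun y : sub_vertex => if y is inr p then tag p else e) eo.
    have := congr1 (fun y : sub_vertex =>
      if y is inr p then tagged p : nat else 0) eo.
    by move=> /= ->; rewrite ee' !eqxx.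
  by move: o; rewrite -ee' => o; rewrite eqSS => /eqP/ord_inj ->.
apply/esym/negbTE; apply: contra ei => /andP[/eqP -> /eqP[->]]; exact: ltn_ord.
Qed.

Lemma arc_eq (x : sub_edge) e i (lt_i : i < len e) :
  (x == arc lt_i) = (tag x == e) && (tagged x == i :> nat).
Proof.
case: x => e' o /=; apply/eqP/andP => [eo|[/eqP ee' /eqP oi]].
  have /= ee' := congr1 (fun x : sub_edge => tag x) eo.
  by have := congr1 (fun x : sub_edge => tagged x : nat) eo => /= ->; rewrite ee' !eqxx.
by move: o oi; rewrite ee' => o oi; congr existT; apply: ord_inj.
Qed.

(** Along a path the boundaries of the arcs telescope. *)
Lemma odd_at_lift (D : {set E}) (y : sub_vertex) :
  odd_at sub_src sub_dst (sub_lift D) y =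
  if y is inl x then odd_at src dst D x else false.
Proof.
transitivity (\big[addb/false]_(e in D)
               (((inl (src e) : sub_vertex) == y) (+) (inl (dst e) == y))).
  transitivity (\big[addb/false]_(e in D) \big[addb/false]_(i < len e)
                 ((sub_point e i == y) (+) (sub_point e i.+1 == y))).
    rewrite (sig_big_dep _ _ (fun e (i : 'I_(len e)) =>
       (sub_point e i == y) (+) (sub_point e i.+1 == y))) /=.
    by apply: eq_bigl => x; rewrite inE andbT.
  apply: eq_bigr => e _.
  rewrite -(big_mkord xpredT (fun i => (sub_point e i == y) (+) (sub_point e i.+1 == y))).
  by rewrite (xor_telescope (fun i => sub_point e i == y)) // sub_point_len.
by case: y => [x|p]; [apply: eq_bigr|rewrite big1].
Qed.

Lemma even_lift (D : {set E}) :
  even_set sub_src sub_dst (sub_lift D) = even_set src dst D.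
Proof.
apply/even_setP/even_setP => De y; last by rewrite odd_at_lift; case: y.
by have := De (inl y); rewrite odd_at_lift.
Qed.

(** An inner vertex has degree 2, so an even set cannot stop there: it contains
    each path entirely or not at all. *)
Lemma even_sub_lift (C : {set sub_edge}) :
  even_set sub_src sub_dst C ->
  C = sub_lift [set e | arc (len_gt0 e) \in C].
Proof.
move=> /even_setP Ce.
have step e i (lt_i : i < len e) (lt_Si : i.+1 < len e) :
    (arc lt_Si \in C) = (arc lt_i \in C).
  have lt_o : i < (len e).-1 by rewrite -ltnS prednK.
  have := Ce (inner_vertex (Ordinal lt_o)); rewrite /odd_at big_split /=.
  under eq_bigr => x _ do rewrite sub_point_inner /= -(arc_eq x lt_Si).
  under [X in _ (+) X]eq_bigr => x _ do
    rewrite sub_point_inner /= eqSS -(arc_eq x lt_i).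
  by rewrite !xor_sum_mem; do 2!case: (_ \in C).
apply/setP=> -[e [i lt_i]]; rewrite !inE /=.
rewrite -[existT _ _ _]/(arc lt_i).
elim: i lt_i => [|i IHi] lt_i; first by congr (arc _ \in C); apply: bool_irrelevance.
by rewrite -(IHi (ltnW lt_i)); apply: step.
Qed.

Lemma circuit_sub_lift (C : {set sub_edge}) :
  circuit sub_src sub_dst C ->
  exists2 D, circuit src dst D & C = sub_lift D.
Proof.
move=> cC; have [D eC] : exists D, C = sub_lift D.
  by eexists; apply: even_sub_lift (circuit_even cC).
exists D => //.
have liftE (A : {set E}) e : (e \in A) = (arc (len_gt0 e) \in sub_lift A).
  by rewrite inE.
have lift0 (A : {set E}) : (sub_lift A != set0) = (A != set0).
  apply/set0Pn/set0Pn => [[x]|[e eA]]; first by rewrite inE; exists (tag x).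
  by exists (arc (len_gt0 e)); rewrite inE.
apply/minsetP; split=> [|A /andP[A0 Ae] AD].
  by rewrite -lift0 -even_lift -eC circuit_even // (circuit_neq0 cC).
have AC : sub_lift A = C.
  apply: (circuit_minimal cC); rewrite ?lift0 ?even_lift //.
  by rewrite eC; apply/subsetP => x; rewrite !inE; apply: (subsetP AD).
by apply/setP => e; rewrite !liftE AC eC.
Qed.

Lemma card_sub_lift (D : {set E}) : #|sub_lift D| = \sum_(e in D) len e.
Proof.
rewrite -sum1_card; transitivity (\sum_(e in D) \sum_(i < len e) 1); last first.
  by apply: eq_bigr => e _; rewrite sum1_card card_ord.
rewrite (sig_big_dep _ _ (fun e (i : 'I_(len e)) => 1)) /=.
by apply: eq_bigl => x; rewrite inE andbT.
Qed.

Lemma card_sub_edge : #|sub_edge| = \sum_e len e.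
Proof.
rewrite card_tagged sumnE big_map big_enum.
by apply: eq_bigr => e _; rewrite card_ord.
Qed.

(** Subdivision preserves the cyclomatic number. *)
Lemma card_sub_vertex : #|sub_vertex| + #|E| = #|V| + #|sub_edge|.
Proof.
rewrite card_sum card_tagged sumnE big_map big_enum card_sub_edge -addnA; congr addn.
rewrite -[#|E|]sum1_card -big_split; apply: eq_bigr => e _.
by rewrite card_ord /= addn1 prednK.
Qed.

End Subdivision.

(** * Bouquets of fans *)

Section Bouquet.
(* The blocks are the loops, indexed by S, and the fans, indexed by B; K indexes
   the pendant edges. *)
Variables (S B K : finType) (m : nat).

Definition bq_vertex : finType := option ((B * 'I_m) + K).
Definition bq_edge : finType := ((S + K) + B * ('I_m.+1 + 'I_m))%type.

Definition hub : bq_vertex := None.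

(** Both j = 0 and j > m give the hub, where the rim starts and ends. *)
Definition joint (b : B) (j : nat) : bq_vertex :=
  if j is j'.+1 then
    if (insub j' : option 'I_m) is Some o then Some (inl (b, o)) else hub
  else hub.

Arguments joint : simpl never.

Definition loop (s : S) : bq_edge := inl (inl s).
Definition pendant (k : K) : bq_edge := inl (inr k).
Definition rim (b : B) (l : 'I_m.+1) : bq_edge := inr (b, inl l).
Definition spoke (b : B) (l : 'I_m) : bq_edge := inr (b, inr l).

Definition bq_src (e : bq_edge) : bq_vertex :=
  if e is inr (b, inl l) then joint b l else hub.

Definition bq_dst (e : bq_edge) : bq_vertex :=
  match e with
  | inl (inl _) => hub
  | inl (inr k) => Some (inr k)
  | inr (b, inl l) => joint b l.+1
  | inr (b, inr l) => joint b l.+1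
  end.

Lemma joint_eq b j b' o :
  (joint b j == Some (inl (b', o))) = (b == b') && (j == o.+1).
Proof.
rewrite /joint; case: j => [|j]; first by rewrite andbF.
case: insubP => [o' _ <-|jm]; first by [].
apply/esym/negbTE; apply: contra jm => /andP[_ /eqP[->]]; exact: ltn_ord.
Qed.

Lemma joint_leaf b j k : (joint b j == Some (inr k)) = false.
Proof. by rewrite /joint; case: j => [|j] //; case: insub. Qed.

Lemma odd_at_leaf (D : {set bq_edge}) k :
  odd_at bq_src bq_dst D (Some (inr k)) = (pendant k \in D).
Proof.
rewrite -xor_sum_mem; apply: eq_bigr => -[[s|k']|[b [l|l]]] _;
  by rewrite /boundary ?joint_leaf.
Qed.

Lemma odd_at_joint (D : {set bq_edge}) b o :
  odd_at bq_src bq_dst D (Some (inl (b, o))) =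
  (rim b (widen_ord (leqnSn m) o) \in D) (+) (rim b (lift ord0 o) \in D)
  (+) (spoke b o \in D).
Proof.
rewrite -!xor_sum_mem -!big_split /=.
apply: eq_bigr => -[[s|k']|[b' [l|l]]] _; rewrite /boundary /= ?joint_eq //.
  rewrite addbC -[RHS]/((b' == b) && (l == o :> nat)
    (+) (b' == b) && (l == o.+1 :> nat) (+) (b' == b) && false).
  by rewrite andbF addbF eqSS.
by rewrite -[RHS]/((b' == b) && false (+) (b' == b) && false
    (+) (b' == b) && (l == o :> nat)) addbb eqSS.
Qed.

(** The hub imposes no condition, by [even_set_except]. *)
Lemma even_bouquetP (D : {set bq_edge}) :
  reflect ((forall k, pendant k \notin D) /\
           forall b o, (rim b (widen_ord (leqnSn m) o) \in D)
                       (+) (rim b (lift ord0 o) \in D) = (spoke b o \in D))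
          (even_set bq_src bq_dst D).
Proof.
apply: (iffP idP) => [/even_setP De|[Dk Db]].
  split=> [k|b o]; first by rewrite -odd_at_leaf De.
  by have := De (Some (inl (b, o))); rewrite odd_at_joint; do 3!case: (_ \in D).
apply: (@even_set_except _ _ _ _ _ hub) => -[[[b o]|k]|] // _.
  by rewrite odd_at_joint Db addbb.
by rewrite odd_at_leaf; apply: negbTE.
Qed.

Definition fan_cycle (b : B) (i j : nat) : {set bq_edge} :=
  [set e : bq_edge | match e with
           | inl _ => false
           | inr (b', inl l) => (b' == b) && (i <= l < j)
           | inr (b', inr l) => (b' == b) && ((l.+1 == i) || (l.+1 == j))
           end].

Lemma fan_cycle_even b i j : i < j -> even_set bq_src bq_dst (fan_cycle b i j).
Proof.
move=> ij; apply/even_bouquetP; split=> [k|b' o]; rewrite !inE //= /bump /=.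
case: (b' == b) => //=; lia.
Qed.

Lemma loop_even s : even_set bq_src bq_dst [set loop s].
Proof. by apply/even_bouquetP; split=> [k|b o]; rewrite !inE. Qed.

(** Follow the rim from the first of its edges in D, say at the joint i, to the
    first joint j where it leaves D: evenness at i and j puts both spokes in D,
    and minimality leaves nothing else. *)
Lemma circuit_bouquet (D : {set bq_edge}) : circuit bq_src bq_dst D ->
  (exists s, D = [set loop s]) \/
  exists b i j, i < j <= m.+1 /\ D = fan_cycle b i j.
Proof.
move=> cD; have [Dk Db] := even_bouquetP _ (circuit_even cD).
have [/existsP[s sD]|] := boolP [exists s, loop s \in D]; [left|].
  exists s; apply/esym/(circuit_minimal cD); rewrite ?loop_even ?sub1set //.
  by apply/set0Pn; exists (loop s); rewrite inE.
rewrite negb_exists => /forallP Ds; right.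
have [b [l lD]] : exists b l, rim b l \in D.
  have /set0Pn[[[s|k]|[b [l|l]]] eD] := circuit_neq0 cD.
  - by have := Ds s; rewrite /loop eD.
  - by have := Dk k; rewrite /pendant eD.
  - by exists b, l.
  - have [wD|wD] := boolP (rim b (widen_ord (leqnSn m) l) \in D).
      by exists b, (widen_ord (leqnSn m) l).
    exists b, (lift ord0 l); have := Db b l.
    by rewrite (negPf wD) /spoke eD.
pose p k := (k <= m) && (rim b (inord k) \in D).
have pE (k : 'I_m.+1) : p k = (rim b k \in D).
  by rewrite /p -ltnS ltn_ord inord_val.
have [i [j [ij jm pij pi pj]]] : exists i j, [/\ i < j, j <= m.+1,
    forall k, i <= k < j -> p k, (i == 0) || ~~ p i.-1 & ~~ p j].
  have exi : exists k, p k by exists l; rewrite pE.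
  have pmin := ex_minnP exi; case: pmin => i pi imin.
  have exj : exists k, (i < k) && ~~ p k.
    exists m.+1; rewrite /p ltnn andbT ltnS.
    by case/andP: pi.
  case: (ex_minnP exj) => j /andP[ij npj] jmin; exists i, j; split=> //.
  - by apply: jmin; rewrite /p ltnn andbT ltnS; case/andP: pi.
  - move=> k /andP[ik kj]; case: (eqVneq i k) => [<- //|nik].
    apply: contraTT kj => npk; rewrite -leqNgt jmin // npk andbT.
    by rewrite ltn_neqAle nik.
  - case: i pi imin {exj ij jmin} => // i pi imin /=.
    by apply/negP => /imin; rewrite ltnn.
exists b, i, j; rewrite ij jm; split=> //; apply/esym/(circuit_minimal cD).
- apply/subsetP => -[[s|k]|[b' [k|k]]]; rewrite inE //=.
    by move=> /andP[/eqP -> /pij]; rewrite pE.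
  move=> /andP[/eqP -> ikj]; rewrite -/(spoke b k) -Db -!pE /= /bump leq0n add1n.
  case/orP: ikj => /eqP kij.
    have -> : p k = false by move: pi; rewrite -kij /= => /negbTE.
    by rewrite kij pij ?leqnn.
  rewrite kij (negPf pj) addbF; apply: pij; rewrite -kij ltnSn andbT.
  by rewrite -ltnS kij.
- apply/set0Pn; exists (rim b (inord i)); rewrite inE /= eqxx inordK ?leqnn //.
  exact: leq_trans jm.
- exact: fan_cycle_even.
Qed.

Section Lengths.
(* [pos b j] and [spk b j] are the position on the rim and the spoke length of
   the joint j, so that rim edges get differences of positions as lengths. *)
Variables (w : S -> nat) (pos spk : B -> nat -> nat).

Definition bq_len (e : bq_edge) : nat :=
  match e with
  | inl (inl s) => w s
  | inl (inr _) => 1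
  | inr (b, inl l) => pos b l.+1 - pos b l
  | inr (b, inr l) => spk b l.+1
  end.

(* The hub plays the role of the joints 0 and m + 1, with spokes of length 0. *)
Hypothesis spk_first : forall b, spk b 0 = 0.
Hypothesis spk_last : forall b, spk b m.+1 = 0.
Hypothesis pos_mono : forall b i, i <= m -> pos b i < pos b i.+1.

Lemma rim_sum b i j : i <= j <= m.+1 ->
  \sum_(l < m.+1 | i <= l < j) (pos b l.+1 - pos b l) = pos b j - pos b i.
Proof.
move=> /andP[ij jm].
rewrite -(big_ord_widen_cond m.+1 (fun l => i <= l) (fun l => pos b l.+1 - pos b l)) //.
rewrite -(big_geq_mkord _ _ xpredT (fun l => pos b l.+1 - pos b l)).
apply: telescope_sumn_in => // k /andP[_ kj]; apply/ltnW/pos_mono.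
by rewrite -ltnS (leq_trans kj).
Qed.

Lemma spoke_sum b i : i <= m.+1 ->
  \sum_(l < m | l.+1 == i) spk b l.+1 = spk b i.
Proof.
case: i => [|i] im; first by rewrite spk_first big_pred0.
have [lt_im|le_mi] := ltnP i m.
  by rewrite (big_pred1 (Ordinal lt_im)).
have -> : i = m by apply/eqP; rewrite eqn_leq le_mi andbT.
by rewrite spk_last big_pred0 // => l; rewrite eqSS ltn_eqF.
Qed.

Lemma fan_cycle_len b i j : i < j <= m.+1 ->
  \sum_(e in fan_cycle b i j) bq_len e + pos b i =
  pos b j + spk b i + spk b j.
Proof.
move=> /andP[ij jm]; rewrite big_sumType /= big_pred0; last by move=> ?; rewrite inE.
have -> : \sum_(p | inr p \in fan_cycle b i j) bq_len (inr p) =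
    \sum_(b' | b' == b) \sum_(y : 'I_m.+1 + 'I_m | match y with
       | inl l => (i <= l < j) | inr l => (l.+1 == i) || (l.+1 == j) end)
      bq_len (inr (b', y)).
  by rewrite pair_big; apply: eq_big => -[b' [l|l]]; rewrite ?inE.
rewrite big_pred1_eq big_sumType /= rim_sum ?(ltnW ij) //.
have -> : \sum_(l < m | (l.+1 == i) || (l.+1 == j)) spk b l.+1 =
    spk b i + spk b j.
  rewrite (bigID (fun l : 'I_m => l.+1 == i)) /= -!spoke_sum ?(ltnW (leq_trans ij _)) //.
  congr (_ + _); apply: eq_bigl => l.
    by case: (_ == i); rewrite ?andbF.
  by have [->|] := eqVneq l.+1 i; rewrite ?(ltn_eqF ij) ?andbF ?andbT.
suff : pos b i <= pos b j by lia.
have mono k : k <= m.+1 -> {in [pred x | x <= k], forall x, pos b x <= pos b k}.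
  elim: k => [|k IHk] km x; first by rewrite inE leqn0 => /eqP ->.
  rewrite inE leq_eqVlt => /predU1P[-> //|]; rewrite ltnS => xk.
  exact: leq_trans (IHk (ltnW km) x xk) (ltnW (pos_mono _ km)).
by apply: (mono j) => //; rewrite inE ltnW.
Qed.

End Lengths.
End Bouquet.

(** * From a bouquet to a realizable pair *)

Section Realization.
Variables (V E : finType) (src dst : E -> V).

(* Renumber the vertices and arcs of any finite graph as ordinals. *)
Let num_src (e : 'I_#|E|) := enum_rank (src (enum_val e)).
Let num_dst (e : 'I_#|E|) := enum_rank (dst (enum_val e)).

Lemma odd_at_enum (C : {set 'I_#|E|}) (x : V) :
  odd_at num_src num_dst C (enum_rank x) = odd_at src dst (enum_val @: C) x.
Proof.
rewrite /odd_at big_imset /=; last by move=> i j _ _; apply: enum_val_inj.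
by apply: eq_bigr => e _; rewrite /boundary !(inj_eq enum_rank_inj).
Qed.

Lemma even_enum (C : {set 'I_#|E|}) :
  even_set num_src num_dst C = even_set src dst (enum_val @: C).
Proof.
apply/even_setP/even_setP => Ce x; first by rewrite -odd_at_enum.
by rewrite -(enum_valK x) odd_at_enum.
Qed.

Lemma circuit_enum (C : {set 'I_#|E|}) :
  circuit num_src num_dst C -> circuit src dst (enum_val @: C).
Proof.
have im0 (A : {set 'I_#|E|}) : (enum_val @: A != set0) = (A != set0).
  by rewrite -!card_gt0 card_imset //; apply: enum_val_inj.
move=> cC; apply/minsetP; split=> [|D /andP[D0 De] DC].
  by rewrite im0 -even_enum (circuit_neq0 cC) circuit_even.
pose A := [set i : 'I_#|E| | enum_val i \in D].
have eD : D = enum_val @: A.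
  apply/setP=> e; apply/idP/imsetP => [eD|[i]]; last by rewrite inE => ? ->.
  by exists (enum_rank e); rewrite ?inE enum_rankK.
suff <- : A = C by []; apply: (circuit_minimal cC).
- apply/subsetP => i; rewrite inE => /(subsetP DC)/imsetP[j jC /enum_val_inj ->].
  exact: jC.
- by rewrite -im0 -eD.
- by rewrite even_enum -eD.
Qed.

Lemma realizable_circuits :
  (forall C D, circuit src dst C -> circuit src dst D -> #|C| = #|D| -> C = D) ->
  realizable #|V| #|E|.
Proof.
move=> distinct; apply/existsP; exists (arc_graph num_src num_dst).
apply/'forall_forallP => C D; apply/implyP => /and3P[cC cD /eqP CD]; apply/eqP.
apply: (imset_inj (@enum_val_inj _ E)); apply: distinct.
- exact/circuit_enum/cycle_circuit.
- exact/circuit_enum/cycle_circuit.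
- by rewrite !card_imset //; apply: enum_val_inj.
Qed.

End Realization.

Section BouquetRealization.
Variables (S B : finType) (m : nat).
Variables (w : S -> nat) (pos spk : B -> nat -> nat) (clen : B -> nat -> nat -> nat).

Hypothesis w_gt0 : forall s, 0 < w s.
Hypothesis spk_gt0 : forall b j, 0 < j <= m -> 0 < spk b j.
Hypothesis spk_first : forall b, spk b 0 = 0.
Hypothesis spk_last : forall b, spk b m.+1 = 0.
Hypothesis pos0 : forall b, pos b 0 = 0.
Hypothesis pos_mono : forall b i, i <= m -> pos b i < pos b i.+1.
Hypothesis clenE : forall b i j, i < j <= m.+1 ->
  clen b i j + pos b i = pos b j + spk b i + spk b j.
Hypothesis w_inj : injective w.
Hypothesis clen_inj : forall b i j b' i' j',
  i < j <= m.+1 -> i' < j' <= m.+1 -> clen b i j = clen b' i' j' ->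
  [/\ b = b', i = i' & j = j'].
Hypothesis w_clen : forall s b i j, i < j <= m.+1 -> w s <> clen b i j.

(** The first premise is Euler's relation for a connected graph with n vertices,
    M edges and cyclomatic number #|S| + #|B| * m.+1; the second one says that
    the blocks have at most M edges, the others becoming pendant. *)
Lemma bouquet_realizable n M :
  n + #|S| + #|B| * m.+1 = M.+1 ->
  \sum_s w s + \sum_b (pos b m.+1 + \sum_(l < m) spk b l.+1) <= M ->
  realizable n M.
Proof.
set Q := (X in X <= M) => nM QM.
pose K : finType := 'I_(M - Q).
pose len := @bq_len S B K m w pos spk.
have len_gt0 e : 0 < len e.
  case: e => [[s|k]|[b [l|l]]] //=; last by apply: spk_gt0; rewrite /= ltn_ord.
  by rewrite subn_gt0; apply: pos_mono; rewrite -ltnS.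
have arcsM : #|sub_edge len| = M.
  rewrite card_sub_edge -[RHS](subnK QM) addnC big_sumType /= big_sumType /= sum1_card.
  rewrite card_ord addnAC; congr (_ + _); rewrite /Q; congr (_ + _).
  transitivity (\sum_b \sum_(y : 'I_m.+1 + 'I_m) len (inr (b, y))).
    by rewrite pair_bigA; apply: eq_bigr => -[].
  apply: eq_bigr => b _.
  rewrite big_sumType /=; congr (_ + _).
  have -> : pos b m.+1 = pos b m.+1 - pos b 0 by rewrite pos0 subn0.
  rewrite -(@rim_sum _ _ _ pos_mono b 0 m.+1) ?leqnn //.
  by apply: eq_big => // l; rewrite ltn_ord.
have cardV : #|sub_vertex (bq_vertex B K m) len| = n.
  have cardVb : #|bq_vertex B K m| = (#|B| * m + (M - Q)).+1.
    by rewrite card_option card_sum card_prod !card_ord.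
  have cardEb : #|bq_edge S B K m| = #|S| + (M - Q) + (#|B| * m.+1 + #|B| * m).
    by rewrite card_sum card_prod !card_sum !card_ord mulnDr.
  have := card_sub_vertex (bq_vertex B K m) len_gt0.
  rewrite arcsM cardVb cardEb => cardVE; move: nM cardVE; rewrite mulnS; lia.
rewrite -arcsM -[n]cardV; apply: (@realizable_circuits _ _
  (sub_src (@bq_src S B K m) (@bq_dst S B K m) (len := len))
  (sub_dst (@bq_src S B K m) (@bq_dst S B K m) (len := len))).
move=> C D /(circuit_sub_lift len_gt0)[C' cC' ->] /(circuit_sub_lift len_gt0)[D' cD' ->].
rewrite !card_sub_lift => CD; congr sub_lift; move: CD.
have fanE b i j : i < j <= m.+1 -> \sum_(e in fan_cycle S K m b i j) len e = clen b i j.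
  move=> ij; apply: (@addIn (pos b i)).
  by rewrite (fan_cycle_len K w spk_first spk_last pos_mono) // clenE.
have [[s ->]|[b [i [j [ij ->]]]]] := circuit_bouquet cC';
  have [[s' ->]|[b' [i' [j' [ij' ->]]]]] := circuit_bouquet cD'.
- by rewrite !big_set1 /= => /w_inj ->.
- by rewrite big_set1 fanE //= => /w_clen -/(_ ij').
- by rewrite big_set1 fanE //= => /esym/w_clen -/(_ ij).
- by rewrite !fanE // => /clen_inj -/(_ ij ij')[-> -> ->].
Qed.

End BouquetRealization.

(** * The family of fans *)

Section Family.

(** The shape of a tile, q < 8 being the number of a fan in it.  The tables come
    from a computer search for u_j = spoke_fine j + pos_fine j and
    v_i = spoke_fine i - pos_fine i such that q |-> u_j q + v_i q is a bijection
    modulo 8 for all pairs i < j other than (0, 1) and (6, 7).  Searching for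
    the two summands instead of u_j and v_j builds in their equal parity.  The
    joints 6 and 7 enter through u_6 = q and u_7 = q + 1. *)
Definition spoke_fine (j q : nat) : nat :=
  nth 0 (nth [::] [:: [::]; [::]; [:: 11; 8; 4; 5; 8; 10; 7; 9];
                      [:: 4; 6; 8; 7; 9; 8; 9; 11];
                      [:: 9; 7; 9; 9; 8; 5; 5; 6];
                      [:: 9; 7; 7; 7; 10; 5; 7; 6]; [:: 0; 1; 2; 3; 4; 5; 6; 7];
                      [:: 0; 1; 2; 3; 4; 5; 6; 7]] j) q.

Definition pos_fine (j q : nat) : nat :=
  nth 0 (nth [::] [:: [::]; [::]; [:: 4; 1; 4; 5; 3; 3; 7; 3];
                      [:: 4; 4; 3; 5; 4; 1; 5; 4];
                      [:: 6; 4; 4; 3; 6; 5; 3; 3];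
                      [:: 2; 5; 1; 6; 5; 5; 7; 3]; [::];
                      [:: 1; 1; 1; 1; 1; 1; 1; 1]] j) q.

Variable w : nat.

(** The coefficients of w in [spk] and in the positions below are U_j + V_j and
    U_j - V_j for the shape (U, V) given at the top, with two changes: U_1 is 10
    instead of 11, where the lengths of the pair (0, 1) begin, and the last rim
    position is U_7 alone.  The joints 1, 6 and 7 depend on t directly, which
    makes the cycles of the pairs (0, 1) and (6, 7) grow by 2 from one fan to
    the next, while V_1 = -8w does not move. *)
Definition spk (t j : nat) : nat :=
  let fine j := 4 * (t %/ 8) + spoke_fine j (t %% 8) in
  nth 0 [:: 0; 6 * w + t; 11 * w + fine 2; 8 * w + fine 3;
            13 * w + fine 4; 8 * w + fine 5; 11 * w + t; 0] j.

Definition pos (t j : nat) : nat :=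
  let fine j := 4 * (t %/ 8) + pos_fine j (t %% 8) in
  nth 0 [:: 0; 14 * w + t; 27 * w + fine 2; 32 * w + fine 3;
            45 * w + fine 4; 60 * w + fine 5; 69 * w; 78 * w + t.+1] j.

Definition cell (i j : nat) : nat :=
  nth 0 [:: 0; 0; 19; 20; 29; 34; 40; 39] j - nth 0 [:: 0; 4; 8; 12; 16; 26] i.

Definition offset (i j q : nat) : nat :=
  (spoke_fine j q + pos_fine j q) + (spoke_fine i q - pos_fine i q).

(** In the plain case, [cell i j] is the cell owned by (i, j), and the tile number
    t %/ 8 and the position in the tile give the place inside this cell. *)
Definition clen (t i j : nat) : nat :=
  if (i, j) == (0, 1) then 20 * w + 2 * t
  else if (i, j) == (6, 7) then 20 * w + (2 * t).+1
  else cell i j * (2 * w) + (8 * (t %/ 8) + offset i j (t %% 8)).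

Lemma mod8_all (P : pred nat) t : all P (iota 0 8) -> P (t %% 8).
Proof. by move=> /allP; apply; rewrite mem_iota add0n ltn_pmod. Qed.

Lemma clenE t i j : i < j <= 7 ->
  clen t i j + pos t i = pos t j + spk t i + spk t j.
Proof.
move=> /andP[ij j7].
have vle k : 2 <= k <= 5 -> pos_fine k (t %% 8) <= spoke_fine k (t %% 8).
  move=> k25; apply: (mod8_all (P := fun q => pos_fine k q <= spoke_fine k q)).
  by case: k k25 => [|[|[|[|[|[|k]]]]]].
have := vle 2 isT; have := vle 3 isT; have := vle 4 isT; have := vle 5 isT.
have q67 : (spoke_fine 6 (t %% 8) = t %% 8) * (spoke_fine 7 (t %% 8) = t %% 8)
    * (pos_fine 7 (t %% 8) = 1).
  split; last exact/eqP/(mod8_all (P := fun q => pos_fine 7 q == 1)).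
  split; [exact/eqP/(mod8_all (P := fun q => spoke_fine 6 q == q))|].
  exact/eqP/(mod8_all (P := fun q => spoke_fine 7 q == q)).
have p6 q : pos_fine 6 q = 0 by exact: nth_nil.
have z0 q : (spoke_fine 0 q = 0) * (spoke_fine 1 q = 0)
    * (pos_fine 0 q = 0) * (pos_fine 1 q = 0).
  by rewrite /spoke_fine /pos_fine /= !nth_nil.
have := divn_eq t 8.
case: j ij j7 => [|[|[|[|[|[|[|[|j]]]]]]]] // ij _;
  case: i ij => [|[|[|[|[|[|[|i]]]]]]] // _;
  rewrite /clen /cell /offset /pos /spk /= ?z0 ?p6 ?q67; lia.
Qed.

(** The pairs that own a whole cell. *)
Definition plain_pairs : seq (nat * nat) :=
  [seq p <- [seq (i, j) | i <- iota 0 8, j <- iota 0 8] |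
     [&& p.1 < p.2, p != (0, 1) & p != (6, 7)]].

Lemma plain_pairsP i j : i < j <= 7 -> (i, j) != (0, 1) -> (i, j) != (6, 7) ->
  (i, j) \in plain_pairs.
Proof.
move=> /andP[ij j7] n01 n67; rewrite mem_filter.
apply/andP; split; first by rewrite /= ij n01 n67.
by apply/allpairsPdep; exists i, j; rewrite !mem_iota; split=> //; lia.
Qed.

Lemma cell_inj (p p' : nat * nat) : p \in plain_pairs -> p' \in plain_pairs ->
  cell p.1 p.2 = cell p'.1 p'.2 -> p = p'.
Proof.
have /allP H : all (fun p => all (fun p' =>
    (cell p.1 p.2 == cell p'.1 p'.2) ==> (p == p')) plain_pairs) plain_pairs.
  by vm_compute.
by move=> /H/allP + /[dup] => /[apply] /implyP + _ cc => /(_ (introT eqP cc))/eqP.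
Qed.

Lemma cell_ge12 (p : nat * nat) : p \in plain_pairs -> 12 <= cell p.1 p.2.
Proof. by move: p; apply/allP; vm_compute. Qed.

Lemma offset_le (p : nat * nat) t :
  p \in plain_pairs -> offset p.1 p.2 (t %% 8) <= 22.
Proof.
move=> pp; apply: (mod8_all (P := fun q => offset p.1 p.2 q <= 22)).
by move: p pp; apply/allP; vm_compute.
Qed.

(** The defining property of a tile. *)
Lemma offset_inj (p : nat * nat) t t' : p \in plain_pairs ->
  offset p.1 p.2 (t %% 8) = offset p.1 p.2 (t' %% 8) %[mod 8] ->
  t %% 8 = t' %% 8.
Proof.
move=> pp oo; apply/eqP; apply: (implyP _ (introT eqP oo)).
apply: (mod8_all (P := fun q =>
  (offset p.1 p.2 q == offset p.1 p.2 (t' %% 8) %[mod 8]) ==> (q == t' %% 8))).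
apply: (mod8_all (P := fun q' => all (fun q =>
  (offset p.1 p.2 q == offset p.1 p.2 q' %[mod 8]) ==> (q == q')) (iota 0 8))).
by move: p pp {oo}; apply/allP; vm_compute.
Qed.

(** The bound on r is what keeps a length inside its cell: offsets reach 22, whence
    the margin of 24 in the number of fans. *)
Variant clen_spec t i j : nat -> Type :=
  | ClenFirst of i = 0 & j = 1 : clen_spec t i j (20 * w + 2 * t)
  | ClenLast of i = 6 & j = 7 : clen_spec t i j (20 * w + (2 * t).+1)
  | ClenPlain r of (i, j) \in plain_pairs & r < 2 * w
      & r = 8 * (t %/ 8) + offset i j (t %% 8) :
      clen_spec t i j (cell i j * (2 * w) + r).

Lemma clenP t i j : t + 24 < 2 * w -> i < j <= 7 -> clen_spec t i j (clen t i j).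
Proof.
move=> tw ij; rewrite /clen; case: eqP => [[-> ->]|/eqP n01]; first by constructor.
case: eqP => [[-> ->]|/eqP n67]; first by constructor.
have pp := plain_pairsP ij n01 n67; constructor=> //.
have := offset_le t pp; have := divn_eq t 8; rewrite /=; lia.
Qed.

(** The quotient by the cell width recovers the pair (i, j), then the residue
    modulo 8 recovers t %% 8, and what is left recovers t %/ 8.  The pairs
    (0, 1) and (6, 7) stay below the other cells and are told apart by parity. *)
Lemma clen_inj t t' i j i' j' : t + 24 < 2 * w -> t' + 24 < 2 * w ->
  i < j <= 7 -> i' < j' <= 7 -> clen t i j = clen t' i' j' ->
  [/\ t = t', i = i' & j = j'].
Proof.
move=> tw tw' ij ij'.
have plain12 k l : (k, l) \in plain_pairs -> 24 * w <= cell k l * (2 * w).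
  by move=> /cell_ge12 /= c12; rewrite mulnA leq_mul2r; lia.
case: (clenP tw ij) => [-> ->|-> ->|r pp rw rE];
  case: (clenP tw' ij') => [-> ->|-> ->|r' pp' rw' rE'];
  try (have := plain12 _ _ pp); try (have := plain12 _ _ pp'); try lia.
- by move=> /addnI /eqP; rewrite eqn_mul2l => /eqP ->.
- by move=> /addnI [] /eqP; rewrite eqn_mul2l => /eqP ->.
move=> _ _ ll.
have w0 : 0 < 2 * w by lia.
have cc : cell i j = cell i' j'.
  have := congr1 (divn ^~ (2 * w)) ll.
  by rewrite !divnMDl // !divn_small // !addn0.
have [ii jj] := cell_inj pp pp' cc; move: ll; rewrite -cc => /addnI; rewrite rE rE' -ii -jj.
move=> rr; have qq : t %% 8 = t' %% 8.
  apply: (offset_inj pp) => /=; have := congr1 (modn ^~ 8) rr.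
  by rewrite ![8 * _]mulnC !modnMDl.
split=> //; move: rr; rewrite qq => /addIn /eqP; rewrite eqn_mul2l /= => /eqP hh.
by rewrite (divn_eq t 8) (divn_eq t' 8) qq hh.
Qed.

Lemma clen_ge t i j : t + 24 < 2 * w -> i < j <= 7 -> 20 * w <= clen t i j.
Proof.
move=> tw ij; case: (clenP tw ij) => [_ _|_ _|r /cell_ge12 /= c12 _ _].
- exact: leq_addr.
- exact: leq_addr.
apply: leq_trans (leq_addr _ _); apply: leq_trans (_ : 12 * (2 * w) <= _); first by lia.
by rewrite leq_mul2r c12 orbT.
Qed.

Lemma pos_mono t i : t + 24 < 2 * w -> i <= 6 -> pos t i < pos t i.+1.
Proof.
have b7 j : pos_fine j (t %% 8) <= 7.
  apply: (mod8_all (P := fun q => pos_fine j q <= 7)).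
  by do 8![case: j => [//|j]]; rewrite /pos_fine /= !nth_nil.
have := b7 2; have := b7 3; have := b7 4; have := b7 5; have := divn_eq t 8.
case: i => [|[|[|[|[|[|[|i]]]]]]] //; rewrite /pos /=; lia.
Qed.

Lemma spk_gt0 t j : 0 < w -> 0 < j <= 6 -> 0 < spk t j.
Proof. by case: j => [|[|[|[|[|[|[|j]]]]]]] // w0 _; rewrite /spk /=; lia. Qed.

Lemma block_arcs t :
  pos t 7 + \sum_(l < 6) spk t l.+1 <= 135 * w + 5 * t + 45.
Proof.
have a11 j : spoke_fine j (t %% 8) <= 11.
  apply: (mod8_all (P := fun q => spoke_fine j q <= 11)).
  by do 8![case: j => [//|j]]; rewrite /spoke_fine /= !nth_nil.
have := a11 2; have := a11 3; have := a11 4; have := a11 5; have := divn_eq t 8.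
rewrite !big_ord_recl big_ord0 /pos /spk /=; lia.
Qed.

End Family.

Lemma sum_linear (a b n : nat) :
  2 * \sum_(t < n) (a + b * t) = n * (2 * a + b * n.-1).
Proof.
elim: n => [|n IHn]; first by rewrite big_ord0.
by rewrite big_ord_recr /= mulnDr IHn; case: n {IHn} => [|n] /=; lia.
Qed.

Lemma family_realizable (w n : nat) : 24 < 2 * w -> 480 * w ^ 2 <= n ->
  realizable n (n + 34 * w - 170).
Proof.
move=> w12 wn; set N := 2 * w - 24.
have tw (t : 'I_N) : t + 24 < 2 * w by have := ltn_ord t; rewrite /N; lia.
apply: (@bouquet_realizable 'I_(20 * w - 1) 'I_N 6 (fun s => s.+1)
  (fun t => pos w t) (fun t => spk w t) (fun t => clen w t)) => //.
- by move=> t j; apply: spk_gt0; lia.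
- by move=> t i i6; apply: pos_mono.
- by move=> t i j; apply: clenE.
- by move=> s s' [] /ord_inj.
- move=> t i j t' i' j' ij ij' /(clen_inj (tw t) (tw t') ij ij')[tt -> ->].
  by split=> //; apply: ord_inj.
- move=> s t i j /(clen_ge (tw t)) + E; rewrite -E; have := ltn_ord s; lia.
- by rewrite !card_ord /N; lia.
apply: leq_trans (_ : \sum_(s < 20 * w - 1) (1 + 1 * s) +
  \sum_(t < N) ((135 * w + 45) + 5 * t) <= _).
  by apply: leq_add; apply: leq_sum => t _; rewrite ?mul1n // addnAC block_arcs.
rewrite -(leq_pmul2l (isT : 0 < 2)) mulnDr !sum_linear.
(* The shift removes all truncated subtractions. *)
have [v wv] : exists v, w = v + 13 by exists (w - 13); lia.
have -> : N = 2 * v + 2 by rewrite /N; lia.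
have -> : 20 * w - 1 = 20 * v + 259 by lia.
have -> : (2 * v + 2).-1 = 2 * v + 1 by lia.
have -> : (20 * v + 259).-1 = 20 * v + 258 by lia.
by move: wn; rewrite wv; nia.
Qed.

(** * The bound *)

Local Open Scope ring_scope.

Lemma realizable_le_f n m : realizable n m -> (m <= f n)%N.
Proof. by rewrite /f; case: ex_maxnP => k _ kmax /kmax. Qed.

(** The leading terms leave room: 480 * 1470^2 < (1309/2) * 1260^2. *)
Lemma vertex_budget (R T N : rat) : T = 1260%:R * R + 169%:R -> 1 <= R ->
  N >= 1309%:R / 2%:R * T ^+ 2 - 1349159%:R / 6%:R * T + 6932215%:R / 3%:R ->
  480%:R * (1470%:R * R - 56%:R) ^+ 2 <= N.
Proof.
move=> -> R1; have : 0 <= (R - 1) * R.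
  by rewrite mulr_ge0 ?subr_ge0 ?(le_trans _ R1).
by lra.
Qed.

(** The slopes in R agree, as 34 * 1470 = (119/3) * 1260, and 56 is the largest
    integer for which the constant terms allow the inequality. *)
Lemma edge_count (R T N M : rat) : T = 1260%:R * R + 169%:R ->
  N + (34%:R * (1470%:R * R - 56%:R) - 170%:R) <= M ->
  N + 119%:R / 3%:R * T - 26399%:R / 3%:R <= M.
Proof. by move=> ->; lra. Qed.

Theorem theorem6 (r : nat) (hr : (1 <= r)%N) (t : nat)
    (ht : t = (1260 * r + 169)%N) (n : nat)
    (hn : n%:R >= 1309%:R / 2%:R * t%:R ^+ 2 - 1349159%:R / 6%:R * t%:R
                  + 6932215%:R / 3%:R :> rat) :
  (f n)%:R >= n%:R + 119%:R / 3%:R * t%:R - 26399%:R / 3%:R :> rat.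
Proof.
have tE : t%:R = 1260%:R * r%:R + 169%:R :> rat by rewrite ht natrD natrM.
have [w wr] : exists w, (w + 56 = 1470 * r)%N by exists (1470 * r - 56)%N; lia.
have wE : w%:R = 1470%:R * r%:R - 56%:R :> rat by rewrite -natrM -wr natrD addrK.
have wn : (480 * w ^ 2 <= n)%N.
  rewrite -(ler_nat rat) natrM natrX wE; apply: (vertex_budget tE _ hn).
  by rewrite (ler_nat _ 1).
have le_f : n%:R + (34%:R * (1470%:R * r%:R - 56%:R) - 170%:R) <= (f n)%:R :> rat.
  (* With hn in the context, [done] would expand its numerals in unary. *)
  clear hn; have w12 : (24 < 2 * w)%N by lia.
  have w170 : (170 <= 34 * w)%N by lia.
  rewrite -wE -natrM -(natrB _ w170) -natrD ler_nat (addnBA _ w170).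
  exact: realizable_le_f (family_realizable w12 wn).
exact: (edge_count tE le_f).
Qed.
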